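(* Let $k$ be even. $\left(M^{(1)},M^{(2)},\ldots,M^{(k/2)}\right)$ is a chained monotone triangle corresponding to a chained alternating sign matrix in $ASM^{\circ}_{n,k}$ if and only if: \begin{enumerate} \item each $M^{(\ell)}$ is a strict Gelfand-Tsetlin pattern of order $n$, and \item for any $1\le\ell\le\frac{k}{2}$, there is no number $i\le n$ such that the following are both true: $i$ appears in the largest row of $M^{(\ell)}$, and $2n-i+1$ appears in the largest row of $M^{(\ell-1)}$, where we consider $M^{(0)}\equiv M^{(k/2)}$. \end{enumerate}
   Context: For positive integers $n,k$, $ASM^{\circ}_{n,k}$ (chained circular alternating sign matrices) is the set of $k$-tuples $(A^{(1)},\dots,A^{(k)})$ of $n\times n$ matrices with entries in $\{-1,0,1\}$ satisfying: (1) $\sum_{j=1}^m A^{(\ell)}_{i,j}\in\{0,1\}$ for all $1\le i\le n$, $1\le m\le n$, $1\le\ell\le k$; (2) $\sum_{j=1}^n A^{(\ell-1)}_{i,j}+\sum_{j=1}^m A^{(\ell)}_{n+1-j,i}\in\{0,1\}$ for all $1\le i\le n$, $1\le m\le n$, $1\le\ell\le k$, where $A^{(0)}\equiv A^{(k)}$; (3) the sum of all entries $\sum_{i,j,\ell}A^{(\ell)}_{i,j}$ is maximized (among all such $k$-tuples satisfying (1) and (2)). Chained monotone triangle: let $k$ be even and $(A^{(1)},\dots,A^{(k)})\in ASM^{\circ}_{n,k}$. For $1\le\ell\le k/2$ let $B^{(\ell)}$ be the $n\times 2n$ matrix obtained by concatenating $A^{(2\ell-1)}$ with the quarter-turn clockwise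 rotation of $A^{(2\ell)}$; i.e. $B^{(\ell)}_{i,j}=A^{(2\ell-1)}_{i,j}$ and $B^{(\ell)}_{i,n+j}=A^{(2\ell)}_{n+1-j,i}$ for $1\le i,j\le n$. Let $M^{(\ell)}$ be the array of numbers whose $m$th row ($1\le m\le n$) lists in increasing order all the $j$ such that the column partial sum $\sum_{i=1}^m B^{(\ell)}_{i,j}$ equals $1$. Then $(M^{(1)},\dots,M^{(k/2)})$ is the chained monotone triangle corresponding to $(A^{(1)},\dots,A^{(k)})$. A Gelfand-Tsetlin pattern of order $n$ is a triangular array $t_{ij}$ with $1\le i\le n$, $1\le j\le i$ (so row $i$ has $i$ entries), such that $t_{i+1,j}\le t_{ij}\le t_{i+1,j+1}$ (whenever these entries are defined). It is strict if, in addition, $t_{ij}<t_{i,j+1}$ (whenever these entries are defined). The largest row is row $n$.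
   Formalization: Condition 1 additionally requires all entries of each M^(ℓ) to lie in {1,…,2n}; without this the ''if'' direction fails, e.g. n=1, k=2, M^(1)=(5) satisfies both conditions but is not a chained monotone triangle. *)

(* Defs.v *)
From HB Require Import structures.
From mathcomp Require Import all_boot all_order all_algebra.

Set Implicit Arguments.
Unset Strict Implicit.
Unset Printing Implicit Defensive.

Import Order.TTheory GRing.Theory Num.Theory.

Local Open Scope ring_scope.

(* Matrix rows, matrix columns and positions in a tuple are numbered from 0,
   so the 1-based index [i] is the ordinal of value [i - 1]; [rev_ord j]
   renders [n + 1 - j] and [ord_pred] is the cyclic predecessor.  The entries
   of triangles are natural numbers that keep the numbering from 1. *)

Section ChainedASM.

Variables n k : nat.

Implicit Type A : 'I_k -> 'M[int]_n.

Definition sign_entries A : Prop :=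
  forall l i j, A l i j \in [:: -1; 0; 1].

Definition row_cond A : Prop :=
  forall (l : 'I_k) (i m : 'I_n),
    \sum_(j < n | (j <= m)%N) A l i j \in [:: 0; 1].

Definition chain_cond A : Prop :=
  forall (l : 'I_k) (i m : 'I_n),
    \sum_(j < n) A (ord_pred l) i j
      + \sum_(j < n | (j <= m)%N) A l (rev_ord j) i \in [:: 0; 1].

Definition admissible A : Prop :=
  [/\ sign_entries A, row_cond A & chain_cond A].

Definition total A : int := \sum_(l < k) \sum_(i < n) \sum_(j < n) A l i j.

Definition chained_ASM A : Prop :=
  admissible A /\ (forall A', admissible A' -> total A' <= total A).

Fact snd_index_proof (l : 'I_(k./2)) : (l.*2.+1 < k)%N.
Proof.
have: (l.+1.*2 <= k)%N by rewrite -geq_half_double.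
by rewrite doubleS.
Qed.

Definition snd_index (l : 'I_(k./2)) : 'I_k := Ordinal (snd_index_proof l).
Definition fst_index (l : 'I_(k./2)) : 'I_k :=
  Ordinal (ltnW (snd_index_proof l)).

Definition concat_mx A (l : 'I_(k./2)) : 'M[int]_(n, n + n) :=
  row_mx (A (fst_index l)) (\matrix_(i, j) A (snd_index l) (rev_ord j) i).

End ChainedASM.

(* A triangular array is the list of its rows. *)
Definition triangle_of (n p : nat) (B : 'M[int]_(n, p)) : seq (seq nat) :=
  [seq [seq (nat_of_ord j).+1 | j : 'I_p <- enum 'I_p
                              & \sum_(i < n | (i <= m)%N) B i j == 1]
  | m : 'I_n <- enum 'I_n].

Definition corresponds (n k : nat) (A : 'I_k -> 'M[int]_n)
    (M : 'I_(k./2) -> seq (seq nat)) : Prop :=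
  forall l, M l = triangle_of (concat_mx A l).

Definition chained_monotone_triangle (n k : nat)
    (M : 'I_(k./2) -> seq (seq nat)) : Prop :=
  exists A : 'I_k -> 'M[int]_n, chained_ASM A /\ corresponds A M.

Local Open Scope nat_scope.

(* Here too [i] and [j] are counted from 0. *)
Definition entry (t : seq (seq nat)) (i j : nat) : nat :=
  nth 0 (nth [::] t i) j.

Definition GT_pattern (n : nat) (t : seq (seq nat)) : Prop :=
  [/\ size t = n,
      forall i, i < n -> size (nth [::] t i) = i.+1
    & forall i j, i.+1 < n -> j <= i ->
        entry t i.+1 j <= entry t i j <= entry t i.+1 j.+1].

Definition strict_GT_pattern (n : nat) (t : seq (seq nat)) : Prop :=
  GT_pattern n t /\
  (forall i j, i < n -> j < i -> entry t i j < entry t i j.+1).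

Definition entries_between (a b : nat) (t : seq (seq nat)) : Prop :=
  forall r x, r \in t -> x \in r -> a <= x <= b.

Definition largest_row (t : seq (seq nat)) : seq nat := last [::] t.

(* Main.v *)
Require Import Defs.
From mathcomp Require Import all_boot all_order all_algebra.
From mathcomp Require Import zify.

(** Why the theorem is true.

    Write R_l(i) for the sum of row [i] of the [l]-th matrix and C_l(i) for the
    sum of its column [i].  Admissibility gives R_(l-1)(i) + C_l(i) <= 1, and
    adding these inequalities over all [l] and [i] counts every matrix twice,
    so twice the total is at most [k * n].  When [k] is even, alternating
    identity and zero matrices reaches this bound; hence an admissible chain is
    maximal exactly when it is saturated, that is when all those inequalities
    are equalities ([chained_ASM_saturated], [saturated_chained_ASM]).

    For a saturated chain, each concatenated matrix has row and column prefix
    sums in {0, 1} and row sums 1, which is called [alternating] here: a row of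
    the concatenation is a row of the first matrix continued by a column of the
    second one read upwards, as in the chain condition, while saturation turns
    the upward column prefix sums of the first matrix into complements of the
    downward ones.  The saturation equalities inside a pair say that the
    row sums are 1; those between consecutive pairs say that the bottom rows of
    the triangles are [complementary]: for each [i] from 1 to [n], either [i]
    occurs in the bottom row of M_l or [2n + 1 - i] occurs in that of M_(l-1),
    but not both.  Conversely, these properties imply that the chain is
    admissible and saturated ([chained_ASM_concat]).

    Alternating matrices correspond to strict Gelfand-Tsetlin patterns
    ([alternating_strict_GT], [alternating_triangle_mx], [triangle_mxK]): the
    prefix sum of row [i] up to column [q] is the number of entries at most [q]
    in row [i] of the triangle minus the same number for the row above, and
    interlacing says precisely that this difference is 0 or 1 ([interlaceP]).

    The theorem only forbids both of [i] and [2n + 1 - i] from occurring.  As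
    every bottom row has [n] entries, counting shows that exactly one of them
    then occurs ([disjoint_complementary]). *)

Set Implicit Arguments.
Unset Strict Implicit.
Unset Printing Implicit Defensive.

Import Order.TTheory GRing.Theory Num.Theory.

Local Open Scope ring_scope.

(** * Prefix sums with values 0 and 1 *)

Lemma in01E (x : int) : (x \in [:: 0; 1]) = (0 <= x <= 1).
Proof. by rewrite !inE; lia. Qed.

Lemma in_signE (x : int) : (x \in [:: -1; 0; 1]) = (-1 <= x <= 1).
Proof. by rewrite !inE; lia. Qed.

Lemma bit_indicator (x : int) : 0 <= x <= 1 -> (x == 1)%:R = x.
Proof. by case: eqP => [->|]; rewrite ?natz; lia. Qed.

Lemma prefix_full p (F : 'I_p -> int) :
  \sum_(j < p | (j < p)%N) F j = \sum_j F j.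
Proof. by apply: eq_bigl => j; rewrite ltn_ord. Qed.

Lemma prefixS p (F : 'I_p -> int) (m : 'I_p) :
  \sum_(j < p | (j <= m)%N) F j = \sum_(j < p | (j < m)%N) F j + F m.
Proof.
rewrite (bigD1 m) //= addrC; congr (_ + _); apply: eq_bigl => j.
by rewrite ltn_neqAle andbC.
Qed.

(** The base value [a] is needed for the chain condition, where a column of one
    matrix continues a complete row of the preceding one. *)
Lemma prefix_bound p (a : int) (F : 'I_p -> int) :
    0 <= a <= 1 ->
    (forall m : 'I_p, 0 <= a + \sum_(j < p | (j <= m)%N) F j <= 1) ->
  forall q, 0 <= a + \sum_(j < p | (j < q)%N) F j <= 1.
Proof.
move=> a01 F01 [|q]; first by rewrite big_pred0 ?addr0.
case: p F F01 => [|p] F F01; first by rewrite big_ord0 addr0.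
have := F01 (inord (minn q p)); rewrite inordK ?ltnS ?geq_minr //.
congr (_ <= a + _ <= _); apply: eq_bigl => j; have := ltn_ord j; lia.
Qed.

Lemma prefix_bound0 p (F : 'I_p -> int) :
    (forall m : 'I_p, 0 <= \sum_(j < p | (j <= m)%N) F j <= 1) ->
  forall q, 0 <= \sum_(j < p | (j < q)%N) F j <= 1.
Proof.
move=> F01 q; rewrite -[X in 0 <= X]add0r -[X in X <= 1]add0r.
by apply: prefix_bound => // m; rewrite add0r.
Qed.

Lemma prefix_bound_total p (F : 'I_p -> int) :
    (forall m : 'I_p, 0 <= \sum_(j < p | (j <= m)%N) F j <= 1) ->
  0 <= \sum_j F j <= 1.
Proof. by move/prefix_bound0/(_ p); rewrite prefix_full. Qed.

Lemma prefix_rev p (F : 'I_p -> int) q :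
  \sum_(j < p | (j < q)%N) F (rev_ord j)
    = \sum_j F j - \sum_(j < p | (j < p - q)%N) F j.
Proof.
rewrite (reindex_inj rev_ord_inj) /=.
rewrite [X in X - _](bigID (fun j : 'I_p => (j < p - q)%N)) /=.
rewrite [X in X - _]addrC addrK.
by apply: eq_big => [j|j _]; rewrite ?rev_ordK //; have := ltn_ord j; lia.
Qed.

(** When the total is fixed to [1 - a], reading the terms backwards from [a]
    gives the complements to 1 of the forward prefix sums. *)
Lemma prefix_complement p (a : int) (F : 'I_p -> int) q : a + \sum_j F j = 1 ->
  (0 <= a + \sum_(j < p | (j < q)%N) F (rev_ord j) <= 1)
    = (0 <= \sum_(j < p | (j < p - q)%N) F j <= 1).
Proof.
by move=> a_sum; rewrite prefix_rev addrA a_sum subr_ge0 gerDl oppr_le0 andbC.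
Qed.

Lemma sum_delta p (P : pred 'I_p) (j : 'I_p) :
  \sum_(i < p | P i) (i == j)%:R = (P j)%:R :> int.
Proof.
rewrite big_mkcond (bigD1 j) //= eqxx big1 ?addr0 => [|i /negbTE->].
  by case: (P j).
by case: ifP.
Qed.

(** The nonnegative slacks [1 - x i j] add up to 0. *)
Lemma saturated_sum (I J : finType) (x : I -> J -> int) :
    (forall i j, x i j <= 1) ->
    \sum_i \sum_j x i j = (#|I| * #|J|)%:R ->
  forall i j, x i j = 1.
Proof.
move=> x_le1 sum_x i j; apply/esym/eqP; rewrite -subr_eq0; apply/eqP.
pose slack (u : I * J) := 1 - x u.1 u.2.
apply: (@psumr_eq0P _ _ predT slack _ _ (i, j)) => // [u _|].
  by rewrite subr_ge0.
rewrite sumrB -(pair_big predT predT (fun _ _ => 1)).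
rewrite -(pair_big predT predT x) /=.
by rewrite sum_x !(sumr_const, card_ord) natrM mulr_natl subrr.
Qed.

(** * Strictly increasing lists and interlacing *)

Definition count_le (q : nat) (s : seq nat) : nat :=
  count (fun x => x <= q)%N s.

Lemma nth_le_count s j q : sorted ltn s -> (j < size s)%N ->
  (nth 0%N s j <= q)%N = (j < count_le q s)%N.
Proof.
elim: s j => //= x s IHs j sx; have s_sorted := path_sorted sx.
case: (leqP x q) => [le_xq|lt_qx].
  by case: j => [|j] /= js; rewrite ?le_xq // add1n ltnS IHs.
have gt_s : all (fun y => q < y)%N s.
  by apply: sub_all (order_path_min ltn_trans sx) => y; apply: ltn_trans.
have -> : count_le q s = 0%N.
  apply/eqP; rewrite -leqn0 leqNgt -has_count -all_predC.
  by apply: sub_all gt_s => y /=; rewrite -ltnNge.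
move=> js; apply/negbTE; rewrite -ltnNge; case: j js => //= j js.
exact: (allP gt_s _ (mem_nth _ js)).
Qed.

Definition interlace (s t : seq nat) : Prop :=
  forall j, (j < size t)%N ->
    (nth 0 s j <= nth 0 t j <= nth 0 s j.+1)%N.

(** Entry [j] of an increasing list is at most [q] exactly when more than [j]
    entries are, so comparing entries amounts to comparing counts.  The shorter
    list may be empty, which covers the top row of a triangle. *)
Lemma interlaceP s t :
    sorted ltn s -> sorted ltn t -> size s = (size t).+1 ->
  interlace s t <->
  forall q, (count_le q t <= count_le q s <= (count_le q t).+1)%N.
Proof.
move=> ss st sz; split=> [st_int q | st_count j jt]; last first.
  have js : (j < size s)%N by rewrite sz; lia.
  have jS : (j.+1 < size s)%N by rewrite sz.
  have := nth_le_count (nth 0%N t j) ss js.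
  have := nth_le_count (nth 0%N t j) st jt.
  have := nth_le_count (nth 0%N s j.+1) ss jS.
  have := nth_le_count (nth 0%N s j.+1) st jt.
  by have := st_count (nth 0%N t j); have := st_count (nth 0%N s j.+1); lia.
have ct := count_size (fun x => x <= q)%N t; rewrite -/(count_le q t) in ct.
have cs := count_size (fun x => x <= q)%N s; rewrite -/(count_le q s) in cs.
apply/andP; split.
  case E: (count_le q t) ct => [//|c] ct.
  have := st_int c ct; have := nth_le_count q st ct.
  by have /(nth_le_count q ss) : (c < size s)%N; lia.
case E: (count_le q s) cs => [//|[//|c]] cs.
have ct' : (c < size t)%N by lia.
have := st_int c ct'; have := nth_le_count q st ct'.
by have := nth_le_count q ss cs; lia.
Qed.

(** * Increasing lists as supports *)

Definition support_row p (f : pred 'I_p) : seq nat :=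
  [seq (nat_of_ord j).+1 | j <- enum 'I_p & f j].

Lemma mem_support_row p (f : pred 'I_p) x :
  reflect (exists2 j : 'I_p, f j & x = j.+1) (x \in support_row f).
Proof.
apply: (iffP mapP) => [[j]|[j fj ->]].
  by rewrite mem_filter => /andP[fj _] ->; exists j.
by exists j; rewrite // mem_filter fj mem_enum.
Qed.

Lemma mem_support_rowS p (f : pred 'I_p) (j : 'I_p) :
  (j.+1 \in support_row f) = f j.
Proof.
by apply/mem_support_row/idP => [[i fi [/ord_inj->]]|fj] //; exists j.
Qed.

Lemma support_row_sorted p (f : pred 'I_p) : sorted ltn (support_row f).
Proof.
rewrite sorted_map; apply: sorted_filter => [i j l|]; first exact: ltn_trans.
by have := iota_ltn_sorted 0 p; rewrite -val_enum_ord sorted_map.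
Qed.

Lemma support_row_mem p (s : seq nat) :
    sorted ltn s -> (forall x, x \in s -> 1 <= x <= p)%N ->
  support_row (fun j : 'I_p => j.+1 \in s) = s.
Proof.
move=> s_sorted s_bnd.
apply: (irr_sorted_eq ltn_trans ltnn (support_row_sorted _) s_sorted) => x.
apply/mem_support_row/idP => [[j js ->] //|xs].
case: x xs (s_bnd _ xs) => // x xs /andP[_ xp].
by exists (Ordinal xp).
Qed.

Lemma count_support_row p (f : pred 'I_p) q :
  (count_le q (support_row f))%:R = \sum_(j < p | (j < q)%N) (f j)%:R :> int.
Proof.
rewrite /count_le -sum1_count big_map big_filter_cond big_enum_cond natr_sum /=.
rewrite [RHS](bigID f) /= [X in _ + X]big1 ?addr0 => [|j /andP[_ /negbTE->] //].
by apply: eq_big => [j|j]; rewrite andbC // => /andP[_ ->].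
Qed.

Lemma size_support_row p (f : pred 'I_p) :
  (size (support_row f))%:R = \sum_j (f j)%:R :> int.
Proof.
rewrite -prefix_full -count_support_row; congr _%:R; symmetry.
by apply/eqP; rewrite -all_count; apply/allP => x /mem_support_row[j _ ->].
Qed.

(** * Matrices with alternating rows and columns, and strict patterns *)

Definition alternating n p (B : 'M[int]_(n, p)) : Prop :=
  [/\ forall (j : 'I_p) (m : 'I_n), 0 <= \sum_(i < n | (i <= m)%N) B i j <= 1,
      forall (i : 'I_n) (m : 'I_p), 0 <= \sum_(j < p | (j <= m)%N) B i j <= 1
    & forall i, \sum_j B i j = 1].

Lemma alternating_entry n p (B : 'M[int]_(n, p)) i j : alternating B ->
  -1 <= B i j <= 1.
Proof.
move=> [_ row01 _]; have := row01 i j; rewrite prefixS.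
have := prefix_bound0 (row01 i) j; lia.
Qed.

Lemma alternating_col_sum n p (B : 'M[int]_(n, p)) j : alternating B ->
  0 <= \sum_i B i j <= 1.
Proof. by case=> col01 _ _; apply: prefix_bound_total. Qed.

Lemma size_triangle_of n p (B : 'M[int]_(n, p)) : size (triangle_of B) = n.
Proof. by rewrite size_map size_enum_ord. Qed.

Lemma nth_triangle_of n p (B : 'M[int]_(n, p)) (m : 'I_n) :
  nth [::] (triangle_of B) m
    = support_row (fun j => \sum_(i < n | (i <= m)%N) B i j == 1).
Proof. by rewrite (nth_map m) ?size_enum_ord // nth_ord_enum. Qed.

Lemma mem_largest_row n p (B : 'M[int]_(n, p)) (j : 'I_p) : (0 < n)%N ->
  (j.+1 \in largest_row (triangle_of B)) = (\sum_i B i j == 1).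
Proof.
case: n B => // n B _; rewrite /largest_row -nth_last size_triangle_of /=.
rewrite (nth_triangle_of B ord_max) mem_support_rowS; congr (_ == _).
by apply: eq_bigl => i; rewrite -ltnS ltn_ord.
Qed.

Lemma count_triangle_of n p (B : 'M[int]_(n, p)) (m : 'I_n) q : alternating B ->
  (count_le q (nth [::] (triangle_of B) m))%:R
    = \sum_(i < n | (i <= m)%N) \sum_(j < p | (j < q)%N) B i j.
Proof.
case=> col01 _ _; rewrite nth_triangle_of count_support_row exchange_big /=.
by apply: eq_bigr => j _; rewrite bit_indicator.
Qed.

Lemma size_nth_triangle_of n p (B : 'M[int]_(n, p)) i : alternating B ->
  (i < n)%N -> size (nth [::] (triangle_of B) i) = i.+1.
Proof.
move=> altB lt_in; have [col01 _ row1] := altB; pose m := Ordinal lt_in.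
apply/eqP; rewrite -eqz_nat -[Posz _]natz -[Posz i.+1]natz; apply/eqP.
rewrite (nth_triangle_of B m) size_support_row.
transitivity (\sum_(i < n | (i <= m)%N) \sum_j B i j).
  rewrite exchange_big; apply: eq_bigr => j _.
  by rewrite bit_indicator.
rewrite (eq_bigr (fun=> 1)) //.
by rewrite -(big_ord_widen n (fun=> 1 : int) lt_in) sumr_const card_ord.
Qed.

(** The interlacing of two consecutive rows comes from [interlaceP]: their
    counts up to [q] differ by a prefix sum of the lower row of the matrix. *)
Lemma alternating_strict_GT n p (B : 'M[int]_(n, p)) : alternating B ->
  strict_GT_pattern n (triangle_of B) /\ entries_between 1 p (triangle_of B).
Proof.
move=> altB; have sz := size_nth_triangle_of altB.
have sorted_row i : (i < n)%N -> sorted ltn (nth [::] (triangle_of B) i).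
  move=> lt_in; rewrite (nth_triangle_of B (Ordinal lt_in)).
  exact: support_row_sorted.
split; last first.
  move=> r x /(nthP [::])[i]; rewrite size_triangle_of => lt_in <-.
  rewrite (nth_triangle_of B (Ordinal lt_in)) => /mem_support_row[j _ ->].
  by rewrite /= ltn_ord.
split; last first.
  move=> i j lt_in lt_ji.
  by rewrite (sorted_ltn_nth ltn_trans) ?inE ?sorted_row ?sz //; lia.
split=> // [|i j lt_in le_ji]; first exact: size_triangle_of.
have lt_in' := ltnW lt_in.
apply: (interlaceP _ _ _).2 => [|||q|]; rewrite ?sz //; try exact: sorted_row.
have := count_triangle_of (Ordinal lt_in) q altB.
rewrite prefixS -[X in _ = X + _](count_triangle_of (Ordinal lt_in') q altB).
rewrite !natz.
have [_ row01 _] := altB.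
by have := prefix_bound0 (row01 (Ordinal lt_in)) q; rewrite /=; lia.
Qed.

(** Row [i] of the matrix of a triangle records which entries appear in, and
    which disappear when passing to, row [i] of the triangle; an empty row is
    put on top so that the first row needs no special case. *)
Definition triangle_mx n p (t : seq (seq nat)) : 'M[int]_(n, p) :=
  \matrix_(i, j) ((j.+1 \in nth [::] t i)%:R
                  - (j.+1 \in nth [::] ([::] :: t) i)%:R).

Lemma triangle_mx_top_sum n p t (m : 'I_n) (j : 'I_p) :
  \sum_(i < n | (i <= m)%N) triangle_mx n p t i j = (j.+1 \in nth [::] t m)%:R.
Proof.
pose f i : int := (j.+1 \in nth [::] ([::] :: t) i)%:R.
under eq_bigr do rewrite mxE.
rewrite -(big_ord_widen n (fun i => f i.+1 - f i) (ltn_ord m)).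
by rewrite -(big_mkord predT (fun i => f i.+1 - f i)) telescope_sumr // subr0.
Qed.

Lemma strict_GT_row_sorted n t i : strict_GT_pattern n t -> (i < n)%N ->
  sorted ltn (nth [::] t i).
Proof.
move=> [[_ sz _] t_strict] lt_in; apply/(sortedP 0%N) => j.
by rewrite sz // ltnS => lt_ji; apply: t_strict.
Qed.

Lemma strict_GT_row_support n p t i :
    strict_GT_pattern n t -> entries_between 1 p t -> (i < n)%N ->
  support_row (fun j : 'I_p => j.+1 \in nth [::] t i) = nth [::] t i.
Proof.
move=> t_strict t_bnd lt_in; have [[sz_t _ _] _] := t_strict.
apply: support_row_mem => [|x]; first exact: strict_GT_row_sorted lt_in.
by apply: t_bnd; rewrite mem_nth // sz_t.
Qed.

Lemma triangle_mxK n p t : strict_GT_pattern n t -> entries_between 1 p t ->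
  triangle_of (triangle_mx n p t) = t.
Proof.
move=> t_strict t_bnd; have [[sz_t _ _] _] := t_strict.
apply: (@eq_from_nth _ [::]) => [|i]; rewrite size_triangle_of.
  by rewrite sz_t.
move=> lt_in.
rewrite (nth_triangle_of _ (Ordinal lt_in)).
rewrite -[RHS](strict_GT_row_support t_strict t_bnd lt_in).
congr map; apply: eq_filter => j; rewrite triangle_mx_top_sum.
by case: (_ \in _).
Qed.

(** A row prefix sum is the difference of the counts of two consecutive rows, so
    that interlacing bounds it; at the last column it is the difference of the
    sizes of these rows, which is 1. *)
Lemma alternating_triangle_mx n p t :
    strict_GT_pattern n t -> entries_between 1 p t ->
  alternating (triangle_mx n p t).
Proof.
move=> t_strict t_bnd; have [[sz_t sz int_t] _] := t_strict.
have row_prefix (i : 'I_n) q : \sum_(j < p | (j < q)%N) triangle_mx n p t i j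
    = (count_le q (nth [::] t i))%:R - (count_le q (nth [::] ([::] :: t) i))%:R.
  under eq_bigr do rewrite mxE.
  rewrite sumrB -!count_support_row (strict_GT_row_support t_strict t_bnd) //.
  congr (_ - (count_le _ _)%:R); case: i => -[|i] lt_in //=.
    by rewrite /support_row filter_pred0.
  by rewrite (strict_GT_row_support t_strict t_bnd) // ltnW.
have row_sorted (i : 'I_n) := strict_GT_row_sorted t_strict (ltn_ord i).
have above_sorted (i : 'I_n) : sorted ltn (nth [::] ([::] :: t) i).
  case: i => -[|i] lt_in //=.
  exact: (strict_GT_row_sorted t_strict) (ltnW lt_in).
have above_size (i : 'I_n) :
    size (nth [::] t i) = (size (nth [::] ([::] :: t) i)).+1.
  by case: i => -[|i] lt_in; rewrite /= !sz // ltnW.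
have above_int (i : 'I_n) : interlace (nth [::] t i) (nth [::] ([::] :: t) i).
  case: i => -[|i] lt_in j //=; rewrite sz ?(ltnW lt_in) // ltnS => le_ji.
  exact: int_t.
split=> [j m|i m|i].
- by rewrite triangle_mx_top_sum; case: (_ \in _).
- rewrite [X in 0 <= X <= 1](row_prefix i m.+1) !natz.
  have int_count := interlaceP (row_sorted i) (above_sorted i) (above_size i).
  by have := int_count.1 (above_int i) m.+1; lia.
have count_all s : (forall x, x \in s -> x <= p)%N -> count_le p s = size s.
  by move=> s_le; apply/eqP; rewrite -all_count; apply/allP.
have row_le i' x : (i' < n)%N -> x \in nth [::] t i' -> (x <= p)%N.
  move=> lt_in xt; have r_in : nth [::] t i' \in t by rewrite mem_nth ?sz_t.
  by have /andP[] := t_bnd _ _ r_in xt.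
rewrite -prefix_full row_prefix !count_all ?above_size ?natz => [|x|x].
- by rewrite intS addrK.
- by case: i => -[|i] lt_in //=; apply: row_le (ltnW lt_in).
- exact: row_le.
Qed.

(** * Concatenating the two matrices of a pair *)

Lemma val_ord_pred m (i : 'I_m) :
  val (ord_pred i) = if val i is i'.+1 then i' else m.-1.
Proof.
case: i => -[|i] lt_im /=; first by rewrite add0n modn_small // prednK.
by rewrite modnDr modn_small // ltnW.
Qed.

Lemma ord_pred_snd k (l : 'I_(k./2)) : ord_pred (snd_index l) = fst_index l.
Proof. by apply: val_inj; rewrite val_ord_pred. Qed.

Lemma ord_pred_fst k (l : 'I_(k./2)) : ~~ odd k ->
  ord_pred (fst_index l) = snd_index (ord_pred l).
Proof.
move=> k_even; apply: val_inj; rewrite val_ord_pred.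
change (val (snd_index (ord_pred l))) with (val (ord_pred l)).*2.+1.
rewrite val_ord_pred; case: l => -[|l] //= k_gt0.
by move: k_gt0; have := odd_double_half k; rewrite (negbTE k_even); lia.
Qed.

Variant pair_index_spec k : 'I_k -> Type :=
  | FstIndex l : pair_index_spec (fst_index l)
  | SndIndex l : pair_index_spec (snd_index l).

Lemma half_proof k (l : 'I_k) : ~~ odd k -> (l./2 < k./2)%N.
Proof. by move=> k_even; have := ltn_ord l; lia. Qed.

Lemma pair_indexP k (l : 'I_k) : ~~ odd k -> pair_index_spec l.
Proof.
move=> k_even; pose h := Ordinal (half_proof l k_even).
have := odd_double_half l; case: odd => /= l_eq.
  by have -> : l = snd_index h; [apply: val_inj | right].
by have -> : l = fst_index h; [apply: val_inj | left].
Qed.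

Section Concat.

Variables (n k : nat) (A : 'I_k -> 'M[int]_n) (l : 'I_(k./2)).

Lemma concat_mx_fst i j : concat_mx A l i (lshift n j) = A (fst_index l) i j.
Proof. by rewrite row_mxEl. Qed.

Lemma concat_mx_snd i j :
  concat_mx A l i (rshift n j) = A (snd_index l) (rev_ord j) i.
Proof. by rewrite row_mxEr mxE. Qed.

Lemma concat_mx_prefix_fst (i m : 'I_n) :
  \sum_(j < n + n | (j <= lshift n m)%N) concat_mx A l i j
    = \sum_(j < n | (j <= m)%N) A (fst_index l) i j.
Proof.
rewrite big_split_ord /= [X in _ + X]big_pred0 => [|j]; last first.
  by have := ltn_ord m; lia.
by rewrite addr0; apply: eq_bigr => j _; rewrite concat_mx_fst.
Qed.

Lemma concat_mx_prefix_snd (i m : 'I_n) :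
  \sum_(j < n + n | (j <= rshift n m)%N) concat_mx A l i j
    = \sum_j A (fst_index l) i j
      + \sum_(j < n | (j <= m)%N) A (snd_index l) (rev_ord j) i.
Proof.
rewrite big_split_ord /=; congr (_ + _); apply: eq_big => j.
- by have := ltn_ord j; lia.
- by rewrite concat_mx_fst.
- by rewrite leq_add2l.
- by rewrite concat_mx_snd.
Qed.

Lemma concat_mx_row_sum i :
  \sum_j concat_mx A l i j
    = \sum_j A (fst_index l) i j + \sum_j A (snd_index l) j i.
Proof.
rewrite big_split_ord /= [X in _ = _ + X](reindex_inj rev_ord_inj) /=.
by congr (_ + _); apply: eq_bigr => j _; rewrite (concat_mx_fst, concat_mx_snd).
Qed.

End Concat.

(** The second matrix of a pair is stored after a clockwise quarter-turn, which
    is undone here. *)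
Definition unconcat n k (k_even : ~~ odd k)
    (B : 'I_(k./2) -> 'M[int]_(n, n + n))
    (l : 'I_k) : 'M[int]_n :=
  let h := Ordinal (half_proof l k_even) in
  if odd l then \matrix_(i, j) rsubmx (B h) j (rev_ord i) else lsubmx (B h).

Lemma unconcatK n k (k_even : ~~ odd k)
    (B : 'I_(k./2) -> 'M[int]_(n, n + n)) l :
  concat_mx (unconcat k_even B) l = B l.
Proof.
apply/matrixP => i j; case: (split_ordP j) => j' ->.
  rewrite concat_mx_fst /unconcat /= odd_double mxE.
  by congr (B _ _ _); apply: val_inj; rewrite /= doubleK.
rewrite concat_mx_snd /unconcat /= odd_double !mxE rev_ordK.
by congr (B _ _ _); apply: val_inj; rewrite /= uphalf_double.
Qed.

(** * Maximal chains are the saturated ones *)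

Definition saturated n k (A : 'I_k -> 'M[int]_n) : Prop :=
  forall l i, \sum_j A (ord_pred l) i j + \sum_j A l j i = 1.

(** Each matrix is counted once through its rows, in the link to its successor,
    and once through its columns, in the link from its predecessor. *)
Lemma double_total n k (A : 'I_k -> 'M[int]_n) :
  Defs.total A *+ 2
    = \sum_l \sum_i (\sum_j A (ord_pred l) i j + \sum_j A l j i).
Proof.
under eq_bigr do rewrite big_split.
rewrite big_split mulr2n /=; congr (_ + _).
  by rewrite /Defs.total (reindex_inj (@ord_pred_inj k)).
by apply: eq_bigr => l _; rewrite exchange_big.
Qed.

Lemma link_le1 n k (A : 'I_k -> 'M[int]_n) l i : admissible A ->
  \sum_j A (ord_pred l) i j + \sum_j A l j i <= 1.
Proof.
move=> [_ row01 chain01].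
have R01 : 0 <= \sum_j A (ord_pred l) i j <= 1.
  by apply: prefix_bound_total => m; rewrite -in01E row01.
have chain_i (m : 'I_n) : 0 <= \sum_j A (ord_pred l) i j
    + \sum_(j < n | (j <= m)%N) A l (rev_ord j) i <= 1.
  by rewrite -in01E chain01.
have /andP[_] := prefix_bound R01 chain_i n.
by rewrite prefix_full [X in _ -> _ + X <= _](reindex_inj rev_ord_inj).
Qed.

Lemma total_le n k (A : 'I_k -> 'M[int]_n) : admissible A ->
  Defs.total A *+ 2 <= (k * n)%:R.
Proof.
move=> A_adm; rewrite double_total mulnC natrM -[k in leRHS]card_ord mulr_natr.
rewrite -sumr_const; apply: ler_sum => l _; rewrite -[n in leRHS]card_ord.
by rewrite -sumr_const; apply: ler_sum => i _; apply: link_le1.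
Qed.

Lemma total_saturated n k (A : 'I_k -> 'M[int]_n) : saturated A ->
  Defs.total A *+ 2 = (k * n)%:R.
Proof.
move=> A_sat; rewrite double_total.
under eq_bigr do under eq_bigr do rewrite A_sat.
by rewrite !sumr_const !card_ord -mulrnA mulnC.
Qed.

Lemma saturated_chained_ASM n k (A : 'I_k -> 'M[int]_n) :
  admissible A -> saturated A -> chained_ASM A.
Proof.
move=> A_adm A_sat; split=> // A' A'_adm.
by have := total_le A'_adm; rewrite -(total_saturated A_sat) lerMn2r.
Qed.

(** As soon as one saturated admissible chain exists, the bound [total_le] is
    attained, so that a maximal chain attains it as well. *)
Lemma chained_ASM_saturated n k (A0 A : 'I_k -> 'M[int]_n) :
  admissible A0 -> saturated A0 -> chained_ASM A -> saturated A.
Proof.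
move=> A0_adm A0_sat [A_adm A_max]; apply: saturated_sum => [l i|].
  exact: link_le1.
rewrite -double_total !card_ord; apply/eqP; rewrite eq_le total_le //=.
by rewrite -(total_saturated A0_sat) lerMn2r A_max.
Qed.

(** The two column sums tell whether [i + 1] is in the bottom row of one
    triangle and whether its opposite [2n - i] is in the bottom row of the
    preceding one. *)
Definition complementary n h (B : 'I_h -> 'M[int]_(n, n + n)) : Prop :=
  forall l i, \sum_r B l r (lshift n i)
                + \sum_r B (ord_pred l) r (rshift n (rev_ord i)) = 1.

Lemma complementary_concat n k (A : 'I_k -> 'M[int]_n) : ~~ odd k ->
  complementary (concat_mx A) <->
  forall l i,
    \sum_j A (ord_pred (fst_index l)) i j + \sum_j A (fst_index l) j i = 1.
Proof.
move=> k_even; split=> A1 l i; rewrite -[RHS](A1 l i) addrC ord_pred_fst //;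
  by congr (_ + _); apply: eq_bigr => j _;
     rewrite ?concat_mx_fst ?concat_mx_snd ?rev_ordK.
Qed.

(** The column prefix sums of the first matrix of a pair are bounded only
    through the chain condition, which reads columns upwards; saturation makes
    the two directions complementary. *)
Lemma concat_saturated n k (A : 'I_k -> 'M[int]_n) : ~~ odd k ->
    admissible A -> saturated A ->
  (forall l, alternating (concat_mx A l)) /\ complementary (concat_mx A).
Proof.
move=> k_even [_ row01 chain01] A_sat; split; last first.
  by apply/complementary_concat => // l i; apply: A_sat.
move=> l; split=> [j m|i m|i].
- case: (split_ordP j) => {}j ->; last first.
    under eq_bigr do rewrite concat_mx_snd.
    by rewrite -in01E row01.
  under eq_bigr do rewrite concat_mx_fst.
  set l1 := fst_index l.
  have R01 : 0 <= \sum_r A (ord_pred l1) j r <= 1.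
    by apply: prefix_bound_total => q; rewrite -in01E row01.
  have chain_j (q : 'I_n) : 0 <= \sum_r A (ord_pred l1) j r
      + \sum_(r < n | (r <= q)%N) A l1 (rev_ord r) j <= 1.
    by rewrite -in01E chain01.
  have := prefix_bound R01 chain_j (n - m.+1)%N.
  by rewrite (prefix_complement (F := (A l1)^~ j)) ?A_sat // subKn.
- case: (split_ordP m) => {}m ->.
    by rewrite concat_mx_prefix_fst -in01E row01.
  by rewrite concat_mx_prefix_snd -in01E -ord_pred_snd chain01.
by rewrite concat_mx_row_sum -ord_pred_snd A_sat.
Qed.

Lemma saturated_concat n k (A : 'I_k -> 'M[int]_n) : ~~ odd k ->
    (forall l, alternating (concat_mx A l)) -> complementary (concat_mx A) ->
  admissible A /\ saturated A.
Proof.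
move=> k_even A_alt /complementary_concat-/(_ k_even) A_compl.
have A_sat : saturated A.
  move=> l i; case: (pair_indexP l k_even) => {}l; first exact: A_compl.
  by rewrite ord_pred_snd -concat_mx_row_sum; have [] := A_alt l.
have row01 : row_cond A.
  move=> l i m; rewrite in01E.
  case: (pair_indexP l k_even) => {}l; have [col01 row01 _] := A_alt l.
    by rewrite -concat_mx_prefix_fst.
  have := col01 (rshift n (rev_ord i)) m.
  by under eq_bigr do rewrite concat_mx_snd rev_ordK.
split=> //; split=> // [l i j|l i m].
  rewrite in_signE; case: (pair_indexP l k_even) => {}l.
    by rewrite -concat_mx_fst alternating_entry.
  by rewrite -[i]rev_ordK -concat_mx_snd alternating_entry.
rewrite in01E.
case: (pair_indexP l k_even) => {}l; have [col01 row_alt _] := A_alt l.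
  rewrite (prefix_complement (F := (A (fst_index l))^~ i) m.+1) ?A_sat //.
  have := prefix_bound0 (col01 (lshift n i)) (n - m.+1).
  by under eq_bigr do rewrite concat_mx_fst.
by rewrite ord_pred_snd -concat_mx_prefix_snd.
Qed.

(** The chain alternating identity and zero matrices.  It is given through its
    concatenations, so that [saturated_concat] provides its admissibility. *)
Lemma exists_saturated n k : ~~ odd k ->
  exists A : 'I_k -> 'M[int]_n, admissible A /\ saturated A.
Proof.
move=> k_even.
pose A := unconcat k_even (fun=> row_mx 1%:M 0 : 'M[int]_(n, n + n)).
have A_fst l r i : concat_mx A l r (lshift n i) = (r == i)%:R.
  by rewrite unconcatK row_mxEl mxE.
have A_snd l r i : concat_mx A l r (rshift n i) = 0.
  by rewrite unconcatK row_mxEr mxE.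
have A_delta l r j : concat_mx A l r j = (j == lshift n r)%:R.
  case: (split_ordP j) => {}j ->; last by rewrite A_snd eq_rlshift.
  by rewrite A_fst eq_lshift eq_sym.
exists A; apply: saturated_concat => // [l|l i]; last first.
  under eq_bigr do rewrite A_fst.
  under [X in _ + X]eq_bigr do rewrite A_snd.
  by rewrite sum_delta big1.
split=> [j m|i m|i].
- case: (split_ordP j) => {}j ->.
    by under eq_bigr do rewrite A_fst; rewrite sum_delta; case: (_ <= _)%N.
  by under eq_bigr do rewrite A_snd; rewrite big1.
- by under eq_bigr do rewrite A_delta; rewrite sum_delta; case: (_ <= _)%N.
by under eq_bigr do rewrite A_delta; rewrite sum_delta.
Qed.

Lemma chained_ASM_concat n k (A : 'I_k -> 'M[int]_n) : ~~ odd k ->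
  chained_ASM A <->
  (forall l, alternating (concat_mx A l)) /\ complementary (concat_mx A).
Proof.
move=> k_even; split=> [A_ch|[A_alt A_compl]].
  have [A0 [A0_adm A0_sat]] := exists_saturated n k_even.
  have A_sat := chained_ASM_saturated A0_adm A0_sat A_ch.
  by apply: concat_saturated => //; case: A_ch.
have [] := saturated_concat k_even A_alt A_compl.
exact: saturated_chained_ASM.
Qed.

(** * Complementarity of largest rows *)

(** Every entry of every bottom row enters exactly one of the sums bounded by 1.
    Each of the [h] bottom rows has [n] entries and there are [h * n] sums, so
    the average of these sums is 1. *)
Lemma disjoint_complementary n h (B : 'I_h -> 'M[int]_(n, n + n)) :
    (forall l, alternating (B l)) ->
    (forall l i, \sum_r B l r (lshift n i)
                 + \sum_r B (ord_pred l) r (rshift n (rev_ord i)) <= 1) ->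
  complementary B.
Proof.
move=> B_alt B_le1; apply: saturated_sum => //; rewrite !card_ord.
under eq_bigr do rewrite big_split.
rewrite big_split /= [X in _ + X](reindex_inj (@ordS_inj h)) /=.
under [X in _ + X]eq_bigr do rewrite ordSK (reindex_inj rev_ord_inj).
rewrite -big_split /=.
transitivity (\sum_(l < h) \sum_(i < n) (1 : int)).
  apply: eq_bigr => l _; have [_ _ row1] := B_alt l.
  transitivity (\sum_r \sum_j B l r j); last first.
    by apply: eq_bigr => r _; rewrite row1.
  rewrite [RHS]exchange_big [RHS]big_split_ord /=.
  by congr (_ + _); apply: eq_bigr => i _; rewrite rev_ordK.
by rewrite !sumr_const !card_ord -mulrnA mulnC.
Qed.

Local Open Scope nat_scope.

Theorem theorem4p18 (n k : nat) (hn : 0 < n) (hk : 0 < k) (k_even : ~~ odd k)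
    (M : 'I_(k./2) -> seq (seq nat)) :
  chained_monotone_triangle n M <->
  (forall l : 'I_(k./2),
     strict_GT_pattern n (M l) /\ entries_between 1 (2 * n) (M l)) /\
  (forall l : 'I_(k./2),
     ~ exists i : nat,
         [/\ i <= n,
             i \in largest_row (M l)
           & 2 * n - i + 1 \in largest_row (M (ord_pred l))]).
Proof.
have opposite (i : 'I_n) : 2 * n - i.+1 + 1 = (rshift n (rev_ord i)).+1.
  by rewrite /=; have := ltn_ord i; lia.
split=> [[A [/(chained_ASM_concat _ k_even)[A_alt A_compl] M_A]]|[M_pat M_disj]].
  split=> l; rewrite !M_A.
    by rewrite mul2n -addnn; apply: alternating_strict_GT.
  move=> [i [le_in i_in]]; have [_ A_bnd] := alternating_strict_GT (A_alt l).
  pose t := triangle_of (concat_mx A l).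
  have r_in : largest_row t \in t.
    by rewrite /largest_row -nth_last mem_nth // size_triangle_of prednK.
  (* Entries are at least 1, so [i] is one more than the index of a column. *)
  case: i le_in i_in (A_bnd _ _ r_in i_in) => // i lt_in i_in _.
  pose i' := Ordinal lt_in; have := A_compl l i'.
  move: i_in; rewrite (opposite i') -[i.+1]/(lshift n i').+1.
  rewrite !mem_largest_row //.
  by move=> /eqP-> A1 /eqP A2; rewrite A2 in A1.
pose B l := triangle_mx n (n + n) (M l).
have M_bnd l : entries_between 1 (n + n) (M l).
  by rewrite addnn -mul2n; case: (M_pat l).
have B_alt l : alternating (B l).
  by apply: alternating_triangle_mx => //; case: (M_pat l).
have BK l : triangle_of (B l) = M l.
  by apply: triangle_mxK => //; case: (M_pat l).
exists (unconcat k_even B); split=> [|l]; last by rewrite unconcatK BK.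
apply/chained_ASM_concat => //; split=> [l|l i]; rewrite !unconcatK //.
move: l i; apply: disjoint_complementary => // l i.
have := M_disj l; rewrite -!BK => l_disj.
have /andP[_ top_le1] := alternating_col_sum (lshift n i) (B_alt l).
have /andP[_ opp_le1] :=
  alternating_col_sum (rshift n (rev_ord i)) (B_alt (ord_pred l)).
case: (boolP (i.+1 \in largest_row (triangle_of (B l)))) => [i_in|].
  have : 2 * n - i.+1 + 1 \notin largest_row (triangle_of (B (ord_pred l))).
    by apply/negP => opp_in; apply: l_disj; exists i.+1.
  by rewrite opposite mem_largest_row // => opp_neq1; lia.
rewrite -[i.+1]/(lshift n i).+1 mem_largest_row // => top_neq1; lia.
Qed.
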